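(* Let $\emptyset\neq\Delta\subseteq\mathbb{C}$, let $\mathcal{L}=(l_1,\ldots,l_n)$ be a sequence of positive integers with $N=\sum_{i=1}^n l_i$, let $\mathcal{A}\in\{0,*,?\}^{N\times N}$ be a pattern matrix, and let $f^{\mathcal{L}}_{\Delta}$ be a $\Delta$-characteristic vector. Consider the LTI network $\dot x=Ax+Bu$ with $A\in\mathcal{S}(f^{\mathcal{L}}_{\Delta},\mathcal{A})$, with set of control subsystems $V_C\subseteq\{1,\ldots,n\}$ (which determines $B$), and with $\Delta$-network graph $G_{\mathcal{N}}^{\Delta}=(V_{\mathcal{N}},E_{\mathcal{N}})$. If $V_C$ is a zero forcing set of $G_{\mathcal{N}}^{\Delta}$, then the network is $\Delta$-SSC (modal strongly structurally controllable with respect to $\Delta$).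
   Context: Pattern matrices. A pattern matrix has entries in the set of symbols $\{0,*,?\}$. For a $q\times p$ pattern matrix $\mathcal{M}$, its pattern class $\mathcal{P}(\mathcal{M})$ is the set of all $M\in\mathbb{R}^{q\times p}$ with $M(i,j)=0$ whenever $\mathcal{M}(i,j)=0$ and $M(i,j)\neq 0$ whenever $\mathcal{M}(i,j)=*$ (entries with symbol $?$ are arbitrary reals). $\mathcal{M}$ has full row rank if every $M\in\mathcal{P}(\mathcal{M})$ has full row rank. Network. Given $\mathcal{L}=(l_1,\ldots,l_n)$ and $N=\sum_i l_i$, an $N\times N$ matrix $A$ (or pattern matrix $\mathcal{A}$) is partitioned into blocks $A_{ij}$ (resp. $\mathcal{A}_{ij}$) of size $l_i\times l_j$, $1\le i,j\le n$. Node $i\in\{1,\ldots,n\}$ represents subsystem $i$ with system matrix $A_{ii}$; its vertex set $V_i=\{i^1,\ldots,i^{l_i}\}$ is identified with the indices of the $i$-th block among $\{1,\ldots,N\}$. For $Z\subseteq\{1,\ldots,n\}$, $\mathrm{Ver}(Z)=\bigcup_{i\in Z}V_i$. Given a set $V_C\subseteq\{1,\ldots,n\}$ of control subsystems, $B$ is the matrix whose columns are the standard basis vectors $e_k\in\mathbb{R}^N$, $k\in\mathrm{Ver}(V_C)$. $\Delta$-characteristic vector and $\Delta$-specified pattern class. $\Lambda(\cdot)$ denotes the spectrum. A $\Delta$-characteristic vector is a vector $f^{\mathcal{L}}_{\Delta}\in\{0,*,?\}^n$, with $f^{\mathcal{L}}_{\Delta}\in\{*,?\}^n$ if $|\Delta|>1$;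 it encodes available information on $\Lambda(A_{kk})\cap\Delta$. It is either given directly, or obtained from a given set $\mathcal{S}^*$ of system matrices by: $f^{\mathcal{L}}_{\Delta}(k)=*$ if $\Lambda(A_{kk})\cap\Delta=\emptyset$ for all $A\in\mathcal{S}^*$; $f^{\mathcal{L}}_{\Delta}(k)=0$ if $\Delta=\{\mu\}$ and $A_{kk}=\mu I_{l_k}$ for all $A\in\mathcal{S}^*$; $f^{\mathcal{L}}_{\Delta}(k)=?$ otherwise. The $\Delta$-specified pattern class $\mathcal{S}(f^{\mathcal{L}}_{\Delta},\mathcal{A})$ is the set of all $A\in\mathcal{P}(\mathcal{A})$ such that, for each $k$, $\Lambda(A_{kk})\cap\Delta=\emptyset$ if $f^{\mathcal{L}}_{\Delta}(k)=*$, and $A_{kk}=\mu I_{l_k}$ if $\Delta=\{\mu\}$ and $f^{\mathcal{L}}_{\Delta}(k)=0$. $\Delta$-SSC. An eigenvalue $\lambda$ of $A$ is controllable for $(A,B)$ if it is not an eigenvalue of the uncontrollable block in the Kalman controllability decomposition of $(A,B)$; equivalently (PBH test), every nonzero $w\in\mathbb{C}^N$ with $w^TA=\lambda w^T$ satisfies $w^TB\neq 0$. The network is $\Delta$-SSC if for every $\lambda\in\Delta$ and every $A\in\mathcal{S}(f^{\mathcal{L}}_{\Delta},\mathcal{A})$ with $\lambda\in\Lambda(A)$, $\lambda$ is a controllable eigenvalue of $(A,B)$. $\Delta$-network graph. $G_{\mathcal{N}}^{\Delta}=(V_{\mathcal{N}},E_{\mathcal{N}})$ is the directed graph (self-loops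 allowed) with $V_{\mathcal{N}}=\{1,\ldots,n\}$ and $E_{\mathcal{N}}=E^*_{\mathcal{N}}\cup E^?_{\mathcal{N}}$ (disjoint), where: the self-loop $(i,i)$ is absent if $f^{\mathcal{L}}_{\Delta}(i)=0$, lies in $E^*_{\mathcal{N}}$ if $f^{\mathcal{L}}_{\Delta}(i)=*$, and lies in $E^?_{\mathcal{N}}$ if $f^{\mathcal{L}}_{\Delta}(i)=?$; for $i\neq j$, $(j,i)\notin E_{\mathcal{N}}$ if $\mathcal{A}_{ij}=0$, $(j,i)\in E^*_{\mathcal{N}}$ if $\mathcal{A}_{ij}$ has full row rank, and $(j,i)\in E^?_{\mathcal{N}}$ otherwise. If $(v,u)\in E_{\mathcal{N}}$, $u$ is an out-neighbor of $v$; it is strong if $(v,u)\in E^*_{\mathcal{N}}$ and weak if $(v,u)\in E^?_{\mathcal{N}}$ (a node with a self-loop is an out-neighbor of itself). Coloring and zero forcing sets. Start with the nodes of a set $Z$ black and all others white. Coloring rule: a white node $u$ is colored black if there is a node $v$ (black or white, possibly $v=u$) such that $u$ is the only white out-neighbor of $v$ and $(v,u)\in E^*_{\mathcal{N}}$. Apply the rule repeatedly until no further change is possible; the final set of black nodes is the derived set $\mathcal{D}(Z)$. $Z$ is a zero forcing set (ZFS) if $\mathcal{D}(Z)=V_{\mathcal{N}}$. *)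

(* Defs.v *)
From HB Require Import structures.
From mathcomp Require Import all_boot all_order all_algebra.

Set Implicit Arguments.
Unset Strict Implicit.
Unset Printing Implicit Defensive.

Import GRing.Theory.
Local Open Scope ring_scope.

Inductive symbol := Zero | Star | Qmark.

Definition nat_of_symbol (s : symbol) : nat :=
  match s with Zero => 0 | Star => 1 | Qmark => 2 end.
Definition symbol_of_nat (k : nat) : symbol :=
  match k with 0 => Zero | 1 => Star | _ => Qmark end.
Lemma nat_of_symbolK : cancel nat_of_symbol symbol_of_nat.
Proof. by case. Qed.
HB.instance Definition _ := Equality.copy symbol (can_type nat_of_symbolK).

(* [G v u] is the type of the edge from v to u: [Zero] means no edge, [Star]
   an edge of E^*, [Qmark] an edge of E^?. *)
Definition pattern_graph (V : finType) := V -> V -> symbol.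

Section ZeroForcing.
Variables (V : finType) (G : pattern_graph V).

Definition out_neighbor (v : V) : {set V} := [set u | G v u != Zero].

Definition strong_edge (v u : V) : bool := G v u == Star.

Definition forceable (X : {set V}) (u : V) : bool :=
  (u \notin X) &&
  [exists v, strong_edge v u && (out_neighbor v :\: X == [set u])].

Definition color_step : rel {set V} :=
  fun X Y => [exists u, forceable X u && (Y == u |: X)].

Definition derived_set (Z D : {set V}) : Prop :=
  connect color_step Z D /\ forall Y, ~~ color_step D Y.

Lemma derived_set_exists Z : exists D, derived_set Z D.
Proof.
have [D ZD maxD] := @arg_maxnP _ Z (connect color_step Z) (fun X => #|X|)
  (connect0 _ _).
exists D; split=> // Y; apply/negP => DY.
have := maxD _ (connect_trans ZD (connect1 DY)).
case/existsP: DY => u /andP[/andP[uD _] /eqP ->].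
by rewrite cardsU1 uD /= ltnn.
Qed.

Lemma derived_set_unique Z D1 D2 :
  derived_set Z D1 -> derived_set Z D2 -> D1 = D2.
Proof.
suff H D E : derived_set Z D -> derived_set Z E -> D \subset E.
  by move=> d1 d2; apply/eqP; rewrite eqEsubset !H.
move=> [ZD _] [ZE stE].
have : Z \subset E.
  case/connectP: ZE => p; elim: p Z {ZD} => [|X p IHp] Z /=; first by move=> _ ->.
  case/andP=> /existsP[u /andP[_ /eqP ->]] pp /(IHp _ pp).
  exact/subset_trans/subsetUr.
case/connectP: ZD => p; elim: p Z {ZE} => [|X p IHp] Z /=; first by move=> _ ->.
case/andP=> ZX pX lX ZE; apply: (IHp _ pX lX).
case/existsP: ZX => u /andP[/andP[uZ /existsP[v /andP[vu /eqP vZ]]] /eqP ->].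
rewrite subUset ZE andbT sub1set; apply/negPn/negP => uE.
have /negP := stE (u |: E); apply; apply/existsP; exists u; rewrite eqxx andbT.
apply/andP; split=> //; apply/existsP; exists v; rewrite vu /=.
have /setDP[uv _] : u \in out_neighbor v :\: Z by rewrite vZ set11.
by rewrite eqEsubset -{1}vZ setDS //= sub1set in_setD uE.
Qed.

Definition zero_forcing_set (Z : {set V}) : Prop := derived_set Z [set: V].

End ZeroForcing.

(* Imported only now because classical_sets shadows the finset lemma names. *)
From mathcomp Require Import boolp classical_sets reals.
From mathcomp Require Import complex.

Section PatternMatrices.
Variable R : realType.

Definition pattern_class q p (PM : 'M[symbol]_(q, p)) : set 'M[R]_(q, p) :=
  [set M | forall i j, (PM i j = Zero -> M i j = 0) /\
                       (PM i j = Star -> M i j <> 0)].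

Definition pattern_full_row_rank q p (PM : 'M[symbol]_(q, p)) : Prop :=
  forall M, pattern_class PM M -> row_free M.

(* The spectrum of a real matrix is a set of complex numbers. *)
Definition spectrum n (A : 'M[R]_n) : set R[i] :=
  [set lambda | eigenvalue (map_mx (real_complex R) A) lambda].

End PatternMatrices.

Section Controllability.
Variable R : realType.

Definition controllability_matrix n m (A : 'M[R]_n) (B : 'M[R]_(n, m)) :=
  \mxrow_(k < n) (A ^+ k *m B).

Definition controllable n m (A : 'M[R]_n) (B : 'M[R]_(n, m)) : Prop :=
  \rank (controllability_matrix A B) = n.

(* The change of basis T and its inverse S are typed as rectangular matrices
   so that no cast along r + s = n is needed; their being mutually inverse
   forces r + s = n. *)
Definition kalman_decomposition n m r s (A : 'M[R]_n) (B : 'M[R]_(n, m))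
    (A1 : 'M[R]_r) (A12 : 'M[R]_(r, s)) (A2 : 'M[R]_s) (B1 : 'M[R]_(r, m)) :=
  exists (T : 'M[R]_(n, r + s)) (S : 'M[R]_(r + s, n)),
    [/\ T *m S = 1%:M, S *m T = 1%:M,
        S *m A *m T = block_mx A1 A12 0 A2,
        S *m B = col_mx B1 0
      & controllable A1 B1].

Lemma powmx_span n (A : 'M[R]_n) k :
  exists c : 'I_n -> R, A ^+ k = \sum_(i < n) c i *: A ^+ i.
Proof.
case: n A => [|n] A; first by exists (fun=> 0); apply/matrixP => - [].
pose q := 'X^k %% char_poly A; exists (fun i => q`_i).
have -> : A ^+ k = horner_mx A q.
  have : horner_mx A 'X^k = A ^+ k by rewrite rmorphXn /= horner_mx_X.
  rewrite {1}(divp_eq 'X^k (char_poly A)) rmorphD rmorphM /= Cayley_Hamilton.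
  by rewrite mulr0 add0r.
have sq : (size q <= n.+1)%N.
  have := ltn_modp 'X^k (char_poly A).
  by rewrite -size_poly_eq0 size_char_poly /= ltnS.
rewrite -[in LHS](coefK q) (poly_def (size q)) rmorph_sum /=.
rewrite (big_ord_widen n.+1 (fun i => horner_mx A (q`_i *: 'X^i))) //.
rewrite big_mkcond /=; apply: eq_bigr => i _; case: ltnP => [_|iq].
  by rewrite linearZ /= rmorphXn /= horner_mx_X.
by rewrite nth_default ?scale0r.
Qed.

Lemma controllability_span n m (A : 'M[R]_n) (B : 'M[R]_(n, m)) k :
  exists X, A ^+ k *m B = controllability_matrix A B *m X.
Proof.
have [c ->] := powmx_span A k.
exists (\mxcol_(i < n) (c i)%:M); rewrite mul_mxrow_mxcol mulmx_suml.
by apply: eq_bigr => i _; rewrite mul_mx_scalar scalemxAl.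
Qed.

Lemma controllability_spans n m (A : 'M[R]_n) (B : 'M[R]_(n, m)) p (e : 'I_p -> nat) :
  exists X, \mxrow_(i < p) (A ^+ e i *m B) = controllability_matrix A B *m X.
Proof.
have /choice[X XP] := fun i : 'I_p => controllability_span A B (e i).
exists (\mxrow_i X i); rewrite mul_mxrow; exact/eq_mxrow.
Qed.

Lemma kalman_decomposition_exists n m (A : 'M[R]_n) (B : 'M[R]_(n, m)) :
  exists r s A1 A12 A2 B1, @kalman_decomposition n m r s A B A1 A12 A2 B1.
Proof.
set C := controllability_matrix A B; pose r := \rank C.
have rn : (r <= n)%N by exact: rank_leq_row.
have [s En] : exists s, n = (r + s)%N by exists (n - r)%N; rewrite subnKC.
exists r, s; have : \rank C = r by [].
move: r En {rn} => r En; rewrite {}/C; subst n.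
set C := controllability_matrix A B => rC.
pose T := col_ebase C; pose S := invmx T.
have TS : T *m S = 1%:M by rewrite mulmxV ?col_ebase_unit.
have ST : S *m T = 1%:M by rewrite mulVmx ?col_ebase_unit.
have [C1 SC] : exists C1, S *m C = col_mx C1 (0 : 'M_(s, _)).
  exists (usubmx (pid_mx r : 'M_(r + s, _)) *m row_ebase C).
  rewrite -[C in LHS]mulmx_ebase -/T !mulmxA ST mul1mx rC.
  rewrite -[pid_mx r in LHS]vsubmxK mul_col_mx; congr col_mx.
  suff -> : dsubmx (pid_mx r : 'M[R]_(r + s, _)) = 0 by rewrite mul0mx.
  by move=> q; apply/matrixP => i j; rewrite !mxE /= ltnNge leq_addr andbF.
have rC1 : row_free C1.
  rewrite /row_free eqn_leq rank_leq_row /=.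
  have := mxrankM_maxr T (S *m C); rewrite mulmxA TS mul1mx rC SC.
  by move/leq_trans; apply; rewrite -addsmxE addsmx0.
have [X AC] : exists X, A *m C = C *m X.
  have [X XP] := controllability_spans A B (fun i : 'I_(r + s) => i.+1).
  exists X; rewrite -XP mul_mxrow; apply/eq_mxrow => i.
  by rewrite mulmxA exprS.
have [Y BC] : exists Y, B = C *m Y.
  by have [Y] := controllability_span A B 0; rewrite mul1mx; exists Y.
pose A' := S *m A *m T.
have SA : S *m A = A' *m S by rewrite -!mulmxA TS mulmx1.
have A'dl : dlsubmx A' = 0.
  apply: (row_free_inj rC1); rewrite mul0mx.
  have : A' *m col_mx C1 0 = col_mx C1 (0 : 'M_(s, _)) *m X.
    by rewrite -SC mulmxA -SA -!mulmxA AC.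
  rewrite -{1}[A']submxK mul_block_col mul_col_mx mul0mx !mulmx0 !addr0.
  by case/eq_col_mx.
have SB : S *m B = col_mx (C1 *m Y) 0.
  by rewrite BC mulmxA SC mul_col_mx mul0mx.
have A'E : A' = block_mx (ulsubmx A') (ursubmx A') 0 (drsubmx A').
  by rewrite -[LHS]submxK A'dl.
exists (ulsubmx A'), (ursubmx A'), (drsubmx A'), (C1 *m Y), T, S.
split=> //.
set A1 := ulsubmx A'; set B1 := C1 *m Y.
have SAk k : S *m (A ^+ k *m B) = col_mx (A1 ^+ k *m B1) 0.
  elim: k => [|k IHk]; first by rewrite !mul1mx.
  rewrite exprS -[A * _]/(A *m _) -mulmxA (mulmxA S) SA -mulmxA IHk {1}A'E mul_block_col.
  by rewrite !mulmx0 mul0mx !addr0 exprS mulmxA.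
have C1E : C1 = \mxrow_(k < r + s) (A1 ^+ k *m B1).
  have : col_mx C1 (0 : 'M_(s, _)) = \mxrow_(k < r + s) col_mx (A1 ^+ k *m B1) 0.
    by rewrite -SC mul_mxrow; apply/eq_mxrow => k.
  move=> /(congr1 usubmx); rewrite col_mxKu => ->.
  by apply/matrixP => i j; rewrite [LHS]mxE [LHS]mxE col_mxEu [RHS]mxE.
have [Z C1Z] := controllability_spans A1 B1 (fun k : 'I_(r + s) => k).
apply/eqP; rewrite eqn_leq rank_leq_row /= -[leqLHS](eqP rC1) C1E C1Z.
exact: mxrankM_maxl.
Qed.
End Controllability.

Section ControllableEigenvalue.
Variable R : realType.

(* All Kalman decompositions have the same spectrum of the uncontrollable block
   A2, and kalman_decomposition_exists provides one. *)
Definition controllable_eigenvalue n m (A : 'M[R]_n) (B : 'M[R]_(n, m))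
    (lambda : R[i]) : Prop :=
  spectrum A lambda /\
  forall r s A1 A12 A2 B1, @kalman_decomposition R n m r s A B A1 A12 A2 B1 ->
    ~ spectrum A2 lambda.

End ControllableEigenvalue.

Section Network.
Variables (R : realType) (Delta : set R[i]) (n : nat) (l : 'I_n -> nat).
Variables (PA : 'M[symbol]_(\sum_i l i)%N) (f : 'I_n -> symbol) (VC : {set 'I_n}).

Definition characteristic_vector : Prop :=
  (exists x y, [/\ Delta x, Delta y & x <> y]) -> forall k, f k <> Zero.

Definition specified_class : set 'M[R]_(\sum_i l i) :=
  [set A | pattern_class PA A /\ forall k,
     (f k = Star -> (spectrum (submxblock A k k) `&` Delta)%classic = set0) /\
     (f k = Zero -> forall mu, Delta = [set mu]%classic ->
        map_mx (real_complex R) (submxblock A k k) = mu%:M)].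

(* tagnat.sig1 sends an index of a block matrix to the number of its block. *)
Definition Ver (Z : {set 'I_n}) : {set 'I_(\sum_i l i)} :=
  [set x | tagnat.sig1 x \in Z].

Definition input_matrix : 'M[R]_(\sum_i l i, #|Ver VC|) :=
  \matrix_(x, c) (x == enum_val c)%:R.

Definition Delta_SSC : Prop :=
  forall lambda A, Delta lambda -> specified_class A ->
    spectrum A lambda -> controllable_eigenvalue A input_matrix lambda.

(* For distinct i and j, the edge from j to i is read off the block (i, j). *)
Definition network_graph : pattern_graph 'I_n :=
  fun j i =>
    if i == j then f i
    else if submxblock PA i j == const_mx Zero then Zero
    else if `[< pattern_full_row_rank R (submxblock PA i j) >] then Star
    else Qmark.

End Network.

(* Main.v *)
(** If [lambda] is an eigenvalue of an uncontrollable Kalman block, there is a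
    nonzero complex row [w] with [w A = lambda w] and [w B = 0], so the blocks of [w] at
    the control nodes vanish. If the blocks at the black nodes vanish and [v]
    forces [u], the [v]-th block of [w A = lambda w] only involves [w_u], through
    a matrix of full row rank ([A_uv], or [A_uu - lambda I] when [u = v]); hence
    [w_u = 0]. A zero forcing set thus makes [w] vanish altogether. *)

Require Import Defs.
From mathcomp Require Import all_boot all_order all_algebra.
From mathcomp Require Import boolp classical_sets reals.
From mathcomp Require Import complex.

Set Implicit Arguments.
Unset Strict Implicit.

Import GRing.Theory.
Local Open Scope ring_scope.

(** Block [(i, v)] carries the edge from [v] to [i], so the [v]-th block of [w *m A] collects
    exactly the out-neighbors of [v], the nodes that the coloring rule inspects. *)
Lemma mul_submxrow_submxblock (F : pzSemiRingType) m n (l : 'I_n -> nat)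
    (w : 'M[F]_(m, \sum_i l i)) (A : 'M[F]_(\sum_i l i)) (v : 'I_n) :
  submxrow (w *m A) v = \sum_i submxrow w i *m submxblock A i v.
Proof.
by rewrite -{1}(submxrowK w) -{1}(submxblockK A) mul_mxrow_mxblock mxrowK.
Qed.

Lemma pattern_class_submxblock (R : realType) n (l : 'I_n -> nat)
    (PA : 'M[symbol]_(\sum_i l i)) (A : 'M[R]_(\sum_i l i)) (i j : 'I_n) :
  pattern_class PA A -> pattern_class (submxblock PA i j) (submxblock A i j).
Proof. by move=> PAA a b; rewrite !mxE; apply: PAA. Qed.

(** In Kalman coordinates, padding a left eigenvector of [A2] with zeros gives one of the block
    triangular matrix, and it annihilates [col_mx B1 0]. Multiplication by [S] returns to the
    original basis, and [T] undoes it, so the vector stays nonzero. *)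
Lemma uncontrollable_left_eigenvector (R : realType) n m r s
    (A : 'M[R]_n) (B : 'M[R]_(n, m)) (A1 : 'M[R]_r) (A12 : 'M[R]_(r, s))
    (A2 : 'M[R]_s) (B1 : 'M[R]_(r, m)) (lambda : R[i]) :
  kalman_decomposition A B A1 A12 A2 B1 -> spectrum A2 lambda ->
  exists w : 'rV_n, [/\ w != 0,
    w *m map_mx (real_complex R) A = lambda *: w
    & w *m map_mx (real_complex R) B = 0].
Proof.
case=> T [S] [TS ST SAT SB _] /eigenvalueP[v vA v0].
pose c := map_mx (real_complex R).
exists (row_mx (0 : 'rV_r) v *m c _ _ S); split.
- apply: contraNneq v0 => /(congr1 (mulmx^~ (c _ _ T))).
  by rewrite mul0mx -mulmxA -map_mxM ST map_mx1 mulmx1 -row_mx0 => /eq_row_mx[_ ->].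
- have SA : S *m A = block_mx A1 A12 0 A2 *m S.
    by rewrite -SAT -[in RHS]mulmxA TS mulmx1.
  rewrite -mulmxA -map_mxM SA map_mxM mulmxA map_block_mx mul_row_block.
  by rewrite !mul0mx map_mx0 mulmx0 !add0r vA scalemxAl scale_row_mx scaler0.
- rewrite -mulmxA -map_mxM SB map_col_mx mul_row_col map_mx0.
  by rewrite mul0mx mulmx0 addr0.
Qed.

(** The column of the input matrix attached to a vertex [k] is the basis vector at [k], so it reads
    off the [k]-th entry of [w]. *)
Lemma submxrow_control_eq0 (R : realType) n (l : 'I_n -> nat) (VC : {set 'I_n})
    (w : 'rV[R[i]]_(\sum_i l i)) (i : 'I_n) :
  w *m map_mx (real_complex R) (input_matrix R l VC) = 0 -> i \in VC ->
  submxrow w i = 0.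
Proof.
move=> wB iVC; apply/rowP => a; rewrite !mxE.
set k := tagnat.Rank i a.
have kV : k \in Ver l VC by rewrite inE tagnat.Rank1K.
have /rowP/(_ (enum_rank_in kV k)) := wB; rewrite !mxE => <-.
rewrite (bigD1 k) //= !mxE enum_rankK_in // eqxx rmorph1 mulr1.
rewrite [X in _ + X]big1 ?addr0 // => x xk.
by rewrite !mxE enum_rankK_in // (negPf xk) rmorph0 mulr0.
Qed.

Section Forcing.
Variables (R : realType) (Delta : set R[i]) (n : nat) (l : 'I_n -> nat).
Variables (PA : 'M[symbol]_(\sum_i l i)%N) (f : 'I_n -> symbol).
Variables (lambda : R[i]) (A : 'M[R]_(\sum_i l i)) (w : 'rV[R[i]]_(\sum_i l i)).

Hypothesis char_f : characteristic_vector Delta f.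
Hypothesis Dlambda : Delta lambda.
Hypothesis SA : specified_class Delta PA f A.
Hypothesis wA : w *m map_mx (real_complex R) A = lambda *: w.

Notation Ac i j := (map_mx (real_complex R) (submxblock A i j)).
Notation G := (network_graph R PA f).

(** The specified class fixes this block only for a singleton [Delta]. A second element would
    contradict [char_f], so [Delta] is reduced to [lambda]. *)
Lemma Zero_diag_block v : f v = Zero -> Ac v v = lambda%:M.
Proof.
move=> fv; have [_ /(_ v)[_ /(_ fv)]] := SA; apply.
apply/seteqP; split=> [mu Dmu|_ -> //]; apply: contrapT => mul.
by apply: char_f fv; exists mu, lambda.
Qed.

Lemma Zero_edge_block v i : i != v -> G v i = Zero -> Ac i v = 0.
Proof.
rewrite /network_graph => /negPf->; case: eqP => [PA0 _|_]; last by case: ifP.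
apply/matrixP => a b; have [PAA _] := SA.
have [+ _] := pattern_class_submxblock PAA a b.
rewrite PA0 !mxE => -> //.
Qed.

Lemma Star_diag_block_inj v (x : 'rV_(l v)) :
  f v = Star -> x *m Ac v v = lambda *: x -> x = 0.
Proof.
move=> fv xA; apply/eqP/negPn/negP => x0.
have [_ /(_ v)[/(_ fv) DA _]] := SA.
suff : (spectrum (submxblock A v v) `&` Delta)%classic lambda by rewrite DA.
by split=> //; apply/eigenvalueP; exists x.
Qed.

(** Full row rank is known for the real block while [x] is complex; rank is invariant under field
    extension. *)
Lemma Star_edge_block_inj v u (x : 'rV_(l u)) :
  u != v -> G v u = Star -> x *m Ac u v = 0 -> x = 0.
Proof.
rewrite /network_graph => /negPf->; case: ifP => // _; case: asboolP => // full _.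
have [/pattern_class_submxblock/full rA _] := SA.
move: rA; rewrite -(row_free_map (real_complex R)) => rA xA.
by apply: (row_free_inj rA); rewrite mul0mx.
Qed.

Lemma submxrow_forced (X : {set 'I_n}) u :
  (forall i, i \in X -> submxrow w i = 0) -> forceable G X u ->
  submxrow w u = 0.
Proof.
move=> wX /andP[_ /existsP[v /andP[/eqP Gvu /eqP outv]]].
(* As [u] is the only white out-neighbor of [v], any other node is black or receives no edge from
   [v]. *)
have offX i : i != u -> submxrow w i = 0 \/ G v i = Zero.
  move=> iu; case: (boolP (i \in X)) => [/wX|iX]; [by left | right].
  apply/eqP; move: (finset.in_set1 i u); rewrite -outv !inE iX (negPf iu) /=.
  by move/negbFE.
(* The index [v] is set apart: a missing self-loop makes the diagonal block [lambda%:M], not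
   zero. *)
have offv i : i != u -> i != v -> submxrow w i *m Ac i v = 0.
  move=> /offX[-> _|Gvi iv]; first exact: mul0mx.
  by rewrite Zero_edge_block ?mulmx0.
have wv : \sum_i submxrow w i *m Ac i v = lambda *: submxrow w v.
  have /(congr1 (fun x => submxrow x v)) := wA.
  rewrite mul_submxrow_submxblock => wAv.
  transitivity (submxrow (lambda *: w) v); last by apply/rowP => a; rewrite !mxE.
  by rewrite -wAv; apply: eq_bigr => i _; rewrite /submxblock map_mxsub.
(* If [v] forces itself, only the diagonal term survives, and [lambda] is not an eigenvalue of that
   block. *)
case: (eqVneq u v) => [uv|uv].
  rewrite -{v}uv in Gvu outv offX offv wv *.
  apply: Star_diag_block_inj; first by rewrite /network_graph eqxx in Gvu.
  by rewrite -wv [RHS](bigD1 u) //= [X in _ + X]big1 ?addr0 // => i iu; exact: offv.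
apply: (Star_edge_block_inj uv Gvu).
move: wv; rewrite [LHS](bigD1 v) //= [X in _ + X](bigD1 u) //=.
rewrite [X in _ + (_ + X)]big1 ?addr0; last first.
  by move=> i /andP[iv iu]; exact: offv.
(* The forcing node [v] may be white, so its block of [w] need not vanish. Its diagonal term still
   cancels the right-hand side: either that block is zero, or [v] has no self-loop and the diagonal
   block is [lambda%:M]. *)
have -> : submxrow w v *m Ac v v = lambda *: submxrow w v.
  have [|->|] := offX v; first by rewrite eq_sym.
    by rewrite mul0mx scaler0.
  rewrite /network_graph eqxx => /Zero_diag_block ->.
  by rewrite mul_mx_scalar.
by rewrite -[RHS]addr0 => /addrI.
Qed.

Lemma submxrow_connect (Z D : {set 'I_n}) :
  connect (color_step G) Z D ->
  (forall i, i \in Z -> submxrow w i = 0) ->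
  forall i, i \in D -> submxrow w i = 0.
Proof.
case/connectP => p; elim: p Z => [|Y p IHp] Z /=; first by move=> _ ->.
(* The first coloring step adds a single forced node [u], so the vanishing of the blocks passes to
   the enlarged set, where the induction continues. *)
case/andP => /existsP[u /andP[uZ /eqP ->]] pp lp wZ; apply: IHp pp lp _ => i.
by rewrite finset.in_setU1 => /predU1P[->|/wZ //]; exact: submxrow_forced uZ.
Qed.

End Forcing.

Theorem theorem1 (R : realType) (Delta : set R[i]) (n : nat) (l : 'I_n -> nat)
    (PA : 'M[symbol]_(\sum_(i < n) l i)%N) (f : 'I_n -> symbol)
    (VC : {set 'I_n}) :
  (Delta !=set0)%classic ->
  (forall i, (0 < l i)%N) ->
  characteristic_vector Delta f ->
  zero_forcing_set (network_graph R PA f) VC ->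
  Delta_SSC Delta PA f VC.
Proof.
move=> _ _ char_f [VCT _] lambda A Dlambda SA specA; split=> //.
move=> r s A1 A12 A2 B1 kalman spec2.
have [w [w0 wA wB]] := uncontrollable_left_eigenvector kalman spec2.
case/eqP: w0; apply/mxrowP => i; rewrite submxrow0.
apply: (submxrow_connect char_f Dlambda SA wA VCT) => //.
by move=> j; exact: submxrow_control_eq0.
Qed.
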